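(* Let $\mathbf{X}$ be an $\mathcal{M},\mathcal{N}$-adhesive category with pullbacks. If $\mathcal{M}\cap\mathcal{N}$ contains all split monomorphisms and $\mathcal{N}$ contains all $\mathcal{M},\mathcal{N}$-codiagonals, then $\mathcal{M}$ is closed under $\mathcal{M},\mathcal{N}$-unions.
   Context: Classes of arrows. A class $\mathcal{A}$ of arrows is stable under pullbacks (resp. pushouts) if for every pullback (resp. pushout) square with $f:A\to B$, $m:A\to C$, $n:B\to D$, $g:C\to D$, $n\circ f=g\circ m$, $n\in\mathcal{A}$ implies $m\in\mathcal{A}$ (resp. $m\in\mathcal{A}$ implies $n\in\mathcal{A}$); existence of the (co)limits is not assumed. $\mathcal{A}$ is closed under $\mathcal{B}$-decomposition if $g\circ f\in\mathcal{A}$ and $g\in\mathcal{B}$ imply $f\in\mathcal{A}$; closed under decomposition means closed under $\mathcal{A}$-decomposition. Preadhesive structure. A pair $(\mathcal{M},\mathcal{N})$ with $\mathcal{M}$ a class of monomorphisms and $\mathcal{N}$ a class of arrows of $\mathbf{X}$ such that: (1) $\mathcal{M}$ and $\mathcal{N}$ contain all isomorphisms and are closed under composition and decomposition; (2) $\mathcal{N}$ is closed under $\mathcal{M}$-decomposition; (3) $\mathcal{M}$ and $\mathcal{N}$ are stable under pullbacks and pushouts. Van Kampen squares. A pushout square $g:A\to B$, $m:A\to C$, $n:B\to D$, $f:C\to D$ is Van Kampen if for every commutative cube having it as bottom face, with top face $g':A'\to B'$, $m':A'\to C'$, $n':B'\to D'$, $f':C'\to D'$ and vertical arrows $a:A'\to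 A$, $b:B'\to B$, $c:C'\to C$, $d:D'\to D$, such that the two vertical faces containing $a$ are pullbacks, the top face is a pushout if and only if the two vertical faces containing $d$ are pullbacks. $\mathcal{M},\mathcal{N}$-adhesivity. $\mathbf{X}$ is $\mathcal{M},\mathcal{N}$-adhesive if $(\mathcal{M},\mathcal{N})$ is a preadhesive structure on $\mathbf{X}$ and: (1) pullbacks of arrows in $\mathcal{M}$ along arbitrary arrows exist; (2) for $m:X\to Y$ in $\mathcal{M}$ and $n:X\to Z$ in $\mathcal{N}$ a pushout of $m$ and $n$ exists (an $\mathcal{M},\mathcal{N}$-pushout); (3) $\mathcal{M},\mathcal{N}$-pushouts are Van Kampen squares. Codiagonals. If $f:X\to Y$ admits a pushout along itself, with coprojections $y_1,y_2:Y\rightrightarrows Q_f$, its codiagonal $\upsilon_f:Q_f\to Y$ is the unique arrow with $\upsilon_f\circ y_1=\mathrm{id}_Y=\upsilon_f\circ y_2$. An $\mathcal{M},\mathcal{N}$-codiagonal is the codiagonal of an arrow $n\in\mathcal{M}\cap\mathcal{N}$. Unions. $(\mathsf{Sub}(X),\le)$ is the poset of subobjects of $X$ (isomorphism classes $[m]$ of monos into $X$, ordered by factorization). A mono $u:U\to X$ is an $\mathcal{M},\mathcal{N}$-union if there are $m\in\mathcal{M}$ and $n\in\mathcal{M}\cap\mathcal{N}$ with codomain $X$ such that $[u]=[m]\vee[n]$ in $(\mathsf{Sub}(X),\le)$. $\mathcal{M}$ is closed under $\mathcal{M},\mathcal{N}$-unions if it contains all such monos. A split monomorphism is an arrow having a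 left inverse. *)

(* Defs.v *)
Set Implicit Arguments.
Unset Strict Implicit.
Unset Printing Implicit Defensive.

Record category := Category {
  obj :> Type;
  hom : obj -> obj -> Type;
  idm : forall A, hom A A;
  comp : forall A B C, hom B C -> hom A B -> hom A C;
  comp_idl : forall A B (f : hom A B), comp (idm B) f = f;
  comp_idr : forall A B (f : hom A B), comp f (idm A) = f;
  comp_assoc : forall A B C D (h : hom C D) (g : hom B C) (f : hom A B),
    comp h (comp g f) = comp (comp h g) f }.

Arguments hom {X} A B : rename.
Arguments idm {X} A : rename.
Arguments comp {X A B C} g f : rename.

Declare Scope cat_scope.
Delimit Scope cat_scope with cat.
Notation "g ∘ f" := (comp g f) (at level 40, left associativity) : cat_scope.
Open Scope cat_scope.

Definition is_mono (X : category) (A B : X) (m : hom A B) : Prop :=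
  forall (T : X) (x y : hom T A), m ∘ x = m ∘ y -> x = y.

Definition is_iso (X : category) (A B : X) (f : hom A B) : Prop :=
  exists g : hom B A, g ∘ f = idm A /\ f ∘ g = idm B.

Definition is_split_mono (X : category) (A B : X) (f : hom A B) : Prop :=
  exists r : hom B A, r ∘ f = idm A.

(* Both predicates below concern the square
<<
      A --f--> B
      |        |
      m        n
      v        v
      C --g--> D
>>
   with arguments always in the order f, m, n, g. *)
Definition is_pullback (X : category) (A B C D : X)
    (f : hom A B) (m : hom A C) (n : hom B D) (g : hom C D) : Prop :=
  n ∘ f = g ∘ m /\
  forall (T : X) (x : hom T B) (y : hom T C), n ∘ x = g ∘ y ->
    exists! t : hom T A, f ∘ t = x /\ m ∘ t = y.

Definition is_pushout (X : category) (A B C D : X)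
    (f : hom A B) (m : hom A C) (n : hom B D) (g : hom C D) : Prop :=
  n ∘ f = g ∘ m /\
  forall (T : X) (x : hom B T) (y : hom C T), x ∘ f = y ∘ m ->
    exists! t : hom D T, t ∘ n = x /\ t ∘ g = y.

Definition has_pullbacks (X : category) : Prop :=
  forall (B C D : X) (n : hom B D) (g : hom C D),
    exists (A : X) (f : hom A B) (m : hom A C), is_pullback f m n g.

Definition arrows (X : category) := forall A B : X, hom A B -> Prop.

Definition inter (X : category) (M N : arrows X) : arrows X :=
  fun A B f => M A B f /\ N A B f.

Definition contains_isos (X : category) (M : arrows X) : Prop :=
  forall (A B : X) (f : hom A B), is_iso f -> M A B f.

Definition closed_comp (X : category) (M : arrows X) : Prop :=
  forall (A B C : X) (f : hom A B) (g : hom B C),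
    M A B f -> M B C g -> M A C (g ∘ f).

Definition closed_decomp_by (X : category) (M N : arrows X) : Prop :=
  forall (A B C : X) (f : hom A B) (g : hom B C),
    M A C (g ∘ f) -> N B C g -> M A B f.

Definition closed_decomp (X : category) (M : arrows X) : Prop :=
  closed_decomp_by M M.

Definition stable_pullback (X : category) (M : arrows X) : Prop :=
  forall (A B C D : X)
    (f : hom A B) (m : hom A C) (n : hom B D) (g : hom C D),
    is_pullback f m n g -> M B D n -> M A C m.

Definition stable_pushout (X : category) (M : arrows X) : Prop :=
  forall (A B C D : X)
    (f : hom A B) (m : hom A C) (n : hom B D) (g : hom C D),
    is_pushout f m n g -> M A C m -> M B D n.

Record preadhesive (X : category) (M N : arrows X) : Prop := {
  M_mono : forall (A B : X) (m : hom A B), M A B m -> is_mono m;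
  M_isos : contains_isos M;
  N_isos : contains_isos N;
  M_comp : closed_comp M;
  N_comp : closed_comp N;
  M_decomp : closed_decomp M;
  N_decomp : closed_decomp N;
  N_decomp_M : closed_decomp_by N M;
  M_pullback : stable_pullback M;
  N_pullback : stable_pullback N;
  M_pushout : stable_pushout M;
  N_pushout : stable_pushout N }.

(* The primed square is the top face of the cube; the two equations
   [b ∘ g' = g ∘ a] and [c ∘ m' = m ∘ a] are part of the pullback conditions
   on the faces containing [a], and the bottom face commutes as a pushout. *)
Definition van_kampen (X : category) (A B C D : X)
    (g : hom A B) (m : hom A C) (n : hom B D) (f : hom C D) : Prop :=
  is_pushout g m n f /\
  forall (A' B' C' D' : X)
    (g' : hom A' B') (m' : hom A' C') (n' : hom B' D') (f' : hom C' D')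
    (a : hom A' A) (b : hom B' B) (c : hom C' C) (d : hom D' D),
    n' ∘ g' = f' ∘ m' ->
    d ∘ n' = n ∘ b ->
    d ∘ f' = f ∘ c ->
    is_pullback g' a b g ->
    is_pullback m' a c m ->
    (is_pushout g' m' n' f' <->
     is_pullback n' b d n /\ is_pullback f' c d f).

Record adhesive (X : category) (M N : arrows X) : Prop := {
  adhesive_preadhesive : preadhesive M N;
  adhesive_pullbacks :
    forall (B C D : X) (m : hom B D) (h : hom C D), M B D m ->
      exists (A : X) (f : hom A B) (k : hom A C), is_pullback f k m h;
  adhesive_pushouts :
    forall (A B C : X) (m : hom A B) (n : hom A C), M A B m -> N A C n ->
      exists (D : X) (p : hom B D) (q : hom C D), is_pushout m n p q;
  adhesive_van_kampen :
    forall (A B C D : X)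
      (m : hom A B) (n : hom A C) (p : hom B D) (q : hom C D),
      M A B m -> N A C n -> is_pushout m n p q -> van_kampen m n p q }.

(* A codiagonal is determined up to the choice of the pushout of [f] along
   itself; every choice is a codiagonal of [f]. *)
Definition is_codiagonal (X : category) (A B Q : X)
    (f : hom A B) (v : hom Q B) : Prop :=
  exists y1 y2 : hom B Q,
    is_pushout f f y1 y2 /\ v ∘ y1 = idm B /\ v ∘ y2 = idm B.

Definition is_MN_codiagonal (X : category) (M N : arrows X)
    (Q B : X) (v : hom Q B) : Prop :=
  exists (A : X) (n : hom A B), inter M N n /\ is_codiagonal n v.

Definition iso_over (X : category) (A U V : X)
    (u : hom U A) (v : hom V A) : Prop :=
  exists i : hom U V, is_iso i /\ v ∘ i = u.

(* An isomorphism class of monos into [A], given by its members. *)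
Record subobject (X : category) (A : X) := Subobject {
  sub_mem : forall U : X, hom U A -> Prop;
  sub_class : exists (V : X) (v : hom V A), is_mono v /\
    forall (U : X) (u : hom U A), sub_mem u <-> iso_over u v }.

Definition sub_of (X : category) (A V : X) (v : hom V A) (hv : is_mono v) :
    subobject A.
Proof.
exists (fun U (u : hom U A) => iso_over u v).
exists V, v; split; [exact hv | intros U u; apply iff_refl].
Defined.

Definition sub_le (X : category) (A : X) (S T : subobject A) : Prop :=
  exists (U V : X) (u : hom U A) (v : hom V A),
    sub_mem S u /\ sub_mem T v /\ exists h : hom U V, v ∘ h = u.

Definition is_join (X : category) (A : X) (S T J : subobject A) : Prop :=
  sub_le S J /\ sub_le T J /\
  forall K : subobject A, sub_le S K -> sub_le T K -> sub_le J K.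

Definition is_MN_union (X : category) (M N : arrows X)
    (U A : X) (u : hom U A) : Prop :=
  exists (hu : is_mono u)
    (B : X) (m : hom B A) (hm : is_mono m)
    (C : X) (n : hom C A) (hn : is_mono n),
    M B A m /\ inter M N n /\ is_join (sub_of hm) (sub_of hn) (sub_of hu).

Definition closed_MN_unions (X : category) (M N : arrows X) : Prop :=
  forall (U A : X) (u : hom U A), is_MN_union M N u -> M U A u.

Lemma sub_le_of (X : category) (A U V : X) (u : hom U A) (v : hom V A)
    (hu : is_mono u) (hv : is_mono v) :
  sub_le (sub_of hu) (sub_of hv) <-> exists h : hom U V, v ∘ h = u.
Proof.
split.
- intros (U' & V' & u' & v' & (i & (j & _ & ij) & ui) & (k & _ & vk) & h & vh).
  exists (k ∘ h ∘ j).
  rewrite !comp_assoc, vk, vh, <- ui, <- comp_assoc, ij.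
  apply comp_idr.
- intros [h vh]; exists U, V, u, v; repeat split.
  + exists (idm U); split; [|apply comp_idr].
    exists (idm U); split; apply comp_idl.
  + exists (idm V); split; [|apply comp_idr].
    exists (idm V); split; apply comp_idl.
  + exists h; exact vh.
Qed.

(* Main.v *)
(** Let [m ∈ M] and [n ∈ M ∩ N] be subobjects of [A] with intersection [P], and
    let [u : D -> A] be induced on the pushout [D] of [P -> B] and [P -> C].
    It suffices to show [u ∈ M]: then [u] is monic, hence isomorphic over [A]
    to the union.

    Let [y1, y2 : A -> Q] be the cokernel pair of [n], [v] its codiagonal and
    [V = v^*B]. Since [v ∈ N], the arrow [v' : V -> B] is in [N], so
    [R = Q +_V B] exists and is a Van Kampen pushout; write [r : Q -> R].
    The arrow [r y2] is split monic, with retraction induced by [v] and [m].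
    Put [W = A +_B V], the union of [y2] and [V] in [Q]. As [W +_V B = A], the
    Van Kampen property of [R] makes [W -> Q] the pullback of [r y2] along [r],
    so it is in [M]. Finally [D -> A] is the pullback of [W -> Q] along [y1], by
    the Van Kampen property of [W]. *)

Require Import Defs.

Set Implicit Arguments.
Unset Strict Implicit.
Unset Printing Implicit Defensive.

(** * Cancellation, pasting and trivial cases of pullbacks and pushouts *)

Lemma comp_rassoc (X : category) (A B C D : X)
    (g : hom B C) (f : hom A B) (k : hom A C) :
  g ∘ f = k -> forall h : hom D A, g ∘ (f ∘ h) = k ∘ h.
Proof. intros <- h; apply comp_assoc. Qed.

Lemma pushout_hom_ext (X : category) (A B C D T : X)
    (f : hom A B) (m : hom A C) (n : hom B D) (g : hom C D) (s t : hom D T) :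
  is_pushout f m n g -> s ∘ n = t ∘ n -> s ∘ g = t ∘ g -> s = t.
Proof.
intros [sq po] en eg.
destruct (po T (t ∘ n) (t ∘ g)) as (w & _ & uniq).
- rewrite <- !comp_assoc, sq; reflexivity.
- transitivity w; [symmetry|]; apply uniq; auto.
Qed.

Lemma pullback_hom_ext (X : category) (A B C D T : X)
    (f : hom A B) (m : hom A C) (n : hom B D) (g : hom C D) (s t : hom T A) :
  is_pullback f m n g -> f ∘ s = f ∘ t -> m ∘ s = m ∘ t -> s = t.
Proof.
intros [sq pb] ef em.
destruct (pb T (f ∘ t) (m ∘ t)) as (w & _ & uniq).
- rewrite !comp_assoc, sq; reflexivity.
- transitivity w; [symmetry|]; apply uniq; auto.
Qed.

Lemma pullback_cancel (X : category) (A B C D E F : X)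
    (d : hom D B) (t : hom D C) (e : hom B E) (h : hom C E)
    (x : hom A D) (b : hom A F) (n : hom F B) :
  is_pullback d t e h -> is_pullback b (t ∘ x) (e ∘ n) h -> d ∘ x = n ∘ b ->
  is_pullback x b d n.
Proof.
intros pbD pbA sq; split; [exact sq|].
intros S y z yz.
destruct pbA as [sqA pbA].
destruct (pbA S z (t ∘ y)) as (s & [bs ts] & uniq).
- rewrite <- comp_assoc, <- yz, !comp_assoc, (proj1 pbD); reflexivity.
- exists s; split.
  + split; [|exact bs].
    apply (pullback_hom_ext pbD).
    * rewrite comp_assoc, sq, <- comp_assoc, bs; auto.
    * rewrite comp_assoc; exact ts.
  + intros s' [xs' bs']; apply uniq; split; [exact bs'|].
    rewrite <- comp_assoc, xs'; reflexivity.
Qed.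

Lemma pullback_paste (X : category) (A B C D E F : X)
    (d : hom D B) (t : hom D C) (e : hom B E) (h : hom C E)
    (x : hom A D) (b : hom A F) (n : hom F B) :
  is_pullback d t e h -> is_pullback x b d n ->
  is_pullback b (t ∘ x) (e ∘ n) h.
Proof.
intros [sqD pbD] pbA; split.
- rewrite comp_assoc, <- sqD, <- !comp_assoc, (proj1 pbA); reflexivity.
- intros S y z yz.
  destruct (pbD S (n ∘ y) z) as (s & [ds ts] & uniqD).
  { rewrite comp_assoc; exact yz. }
  destruct (proj2 pbA S s y ds) as (w & [xw bw] & uniqA).
  exists w; split.
  + split; [exact bw|]. rewrite <- comp_assoc, xw; exact ts.
  + intros w' [bw' tw']; apply uniqA; split; [|exact bw'].
    symmetry; apply uniqD; split; [|rewrite comp_assoc; exact tw'].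
    rewrite comp_assoc, (proj1 pbA), <- comp_assoc, bw'; reflexivity.
Qed.

Lemma is_pullback_sym (X : category) (A B C D : X)
    (f : hom A B) (m : hom A C) (n : hom B D) (g : hom C D) :
  is_pullback f m n g -> is_pullback m f g n.
Proof.
intros [sq pb]; split; [auto|].
intros T x y xy.
destruct (pb T y x) as (t & [ft mt] & uniq); [auto|].
exists t; split; [auto|]; intros s [ms fs]; apply uniq; auto.
Qed.

Lemma mono_pullback (X : category) (A B D : X) (n : hom B D) (g : hom A B) :
  is_mono n -> is_pullback (idm A) g (n ∘ g) n.
Proof.
intros nm; split; [apply comp_idr|].
intros T x y xy; exists x; repeat split.
- apply comp_idl.
- apply nm; rewrite comp_assoc; exact xy.
- intros t [<- _]; apply comp_idl.
Qed.

Lemma pushout_id (X : category) (A C : X) (s : hom A C) :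
  is_pushout (idm A) s s (idm C).
Proof.
split; [rewrite comp_idl, comp_idr; reflexivity|].
intros T x y xy; rewrite comp_idr in xy; exists y; repeat split; auto.
- apply comp_idr.
- intros t [_ <-]; apply comp_idr.
Qed.

Lemma mono_kernel_pair (X : category) (A B : X) (m : hom A B) :
  is_mono m -> is_pullback (idm A) (idm A) m m.
Proof.
intros mm; generalize (mono_pullback (idm A) mm); rewrite comp_idr; auto.
Qed.

Lemma pullback_id (X : category) (A C : X) (f : hom A C) :
  is_pullback f (idm A) (idm C) f.
Proof.
split; [rewrite comp_idl, comp_idr; reflexivity|].
intros T x y xy; rewrite comp_idl in xy; exists y; repeat split; auto.
- apply comp_idl.
- intros t [_ <-]; apply comp_idl.
Qed.

(** * Van Kampen squares *)

(** Take the cube with vertical arrows [idm A], [m], [idm C], [q] whose top face is the trivial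
    pushout of [n] along an identity. Its faces over [idm A] are the kernel pair of the mono [m] and
    a trivial pullback; one face over [q] is the square in question. *)
Lemma van_kampen_is_pullback (X : category) (A B C D : X)
    (m : hom A B) (n : hom A C) (p : hom B D) (q : hom C D) :
  is_mono m -> van_kampen m n p q -> is_pullback n m q p.
Proof.
intros mm [po vk].
apply (vk A A C C (idm A) n n (idm C) (idm A) m (idm C) q).
- rewrite comp_idl, comp_idr; reflexivity.
- symmetry; apply (proj1 po).
- reflexivity.
- exact (mono_kernel_pair mm).
- apply pullback_id.
- apply pushout_id.
Qed.

(* By the Van Kampen property the actual pullback of [e] along [h] is a pushout
   of the same span as [D'], hence isomorphic to [D']. *)
Lemma van_kampen_stable (X : category) (A B C D : X)
    (g : hom A B) (m : hom A C) (n : hom B D) (f : hom C D)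
    (Q T : X) (e : hom D Q) (h : hom T Q)
    (A' B' C' D' : X)
    (g' : hom A' B') (m' : hom A' C') (n' : hom B' D') (f' : hom C' D')
    (a : hom A' A) (b : hom B' B) (c : hom C' C) (d : hom D' D)
    (t : hom D' T) :
  has_pullbacks X -> van_kampen g m n f -> is_pushout g' m' n' f' ->
  b ∘ g' = g ∘ a -> c ∘ m' = m ∘ a -> d ∘ n' = n ∘ b -> d ∘ f' = f ∘ c ->
  is_pullback a (t ∘ n' ∘ g') (e ∘ n ∘ g) h ->
  is_pullback b (t ∘ n') (e ∘ n) h ->
  is_pullback c (t ∘ f') (e ∘ f) h ->
  is_pullback d t e h.
Proof.
intros hpb [po vk] po' sqb sqc sqn sqf pbA pbB pbC.
assert (sqd : e ∘ d = h ∘ t).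
{ apply (pushout_hom_ext po'); rewrite <- !comp_assoc.
  - rewrite sqn, comp_assoc; apply (proj1 pbB).
  - rewrite sqf, comp_assoc; apply (proj1 pbC). }
destruct (hpb _ _ _ e h) as (E & d'' & t'' & pbE).
destruct (proj2 pbE _ d t sqd) as (phi & [dphi tphi] & _).
assert (poE : is_pushout g' m' (phi ∘ n') (phi ∘ f')).
{ assert (sqn'' : d'' ∘ (phi ∘ n') = n ∘ b)
    by (rewrite comp_assoc, dphi; exact sqn).
  assert (sqf'' : d'' ∘ (phi ∘ f') = f ∘ c)
    by (rewrite comp_assoc, dphi; exact sqf).
  apply (vk _ _ _ _ g' m' (phi ∘ n') (phi ∘ f') a b c d''); auto.
  - rewrite <- !comp_assoc, (proj1 po'); reflexivity.
  - apply (pullback_cancel pbB); auto.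
  (* [pbA] is phrased through [B]; commutativity of both pushout squares rephrases it through
     [C]. *)
  - apply (pullback_cancel pbC); auto.
    rewrite <- !comp_assoc, <- (proj1 po'), <- (proj1 po), !comp_assoc.
    exact pbA.
  - split; apply (pullback_cancel pbE); auto.
    + rewrite comp_assoc, tphi; exact pbB.
    + rewrite comp_assoc, tphi; exact pbC. }
destruct (proj2 poE _ n' f' (proj1 po')) as (psi & [psin psif] & _).
assert (psiphi : psi ∘ phi = idm D').
{ apply (pushout_hom_ext po'); rewrite <- comp_assoc, comp_idl; assumption. }
assert (phipsi : phi ∘ psi = idm E).
{ apply (pushout_hom_ext poE); rewrite <- comp_assoc, comp_idl.
  - rewrite psin; reflexivity.
  - rewrite psif; reflexivity. }
split; [exact sqd|].
intros S x y xy.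
destruct (proj2 pbE S x y xy) as (s & [ds ts] & uniq).
exists (psi ∘ s); repeat split.
- rewrite <- dphi, <- comp_assoc, (comp_rassoc phipsi), comp_idl; exact ds.
- rewrite <- tphi, <- comp_assoc, (comp_rassoc phipsi), comp_idl; exact ts.
- intros s' [ds' ts'].
  rewrite (uniq (phi ∘ s')).
  + rewrite comp_assoc, psiphi; apply comp_idl.
  + rewrite !comp_assoc, dphi, tphi; auto.
Qed.

(** A cone [z], [x] factors through [v' ∘ z], because [m ∘ v' ∘ z = v ∘ mv ∘ z = v ∘ y ∘ x = x]. *)
Lemma pullback_along_section (X : category) (A B Q V : X)
    (m : hom B A) (v : hom Q A) (v' : hom V B) (mv : hom V Q)
    (y : hom A Q) (s : hom B V) :
  is_mono mv -> m ∘ v' = v ∘ mv -> v ∘ y = idm A -> mv ∘ s = y ∘ m ->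
  v' ∘ s = idm B -> is_pullback s m mv y.
Proof.
intros mono_mv sq vy ms vs; split; [exact ms|].
intros T z x zx.
assert (mx : m ∘ (v' ∘ z) = x).
{ rewrite comp_assoc, sq, <- comp_assoc, zx, comp_assoc, vy; apply comp_idl. }
exists (v' ∘ z); repeat split; auto.
- apply mono_mv.
  rewrite comp_assoc, ms, <- comp_assoc, mx; auto.
- intros t [<- _]; rewrite comp_assoc, vs; apply comp_idl.
Qed.

(** * Unions as pushouts over the intersection *)

Section Union.

Variables (X : category) (M N : arrows X).
Hypothesis hMN : adhesive M N.
Hypothesis hpb : has_pullbacks X.
Hypothesis hsplit : forall (A B : X) (f : hom A B),
  is_split_mono f -> inter M N f.
Hypothesis hcodiag : forall (Q B : X) (v : hom Q B),
  is_MN_codiagonal M N v -> N v.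

Let hpre := adhesive_preadhesive hMN.

(* [W] is the union of [y] and [V] in [Q]. *)
Lemma section_union_M (A B Q V W : X)
    (m : hom B A) (v : hom Q A) (v' : hom V B) (mv : hom V Q)
    (y : hom A Q) (s : hom B V) (a : hom A W) (b : hom V W) (j : hom W Q) :
  M m -> N v -> is_pullback mv v' v m -> v ∘ y = idm A ->
  v' ∘ s = idm B -> mv ∘ s = y ∘ m -> is_pushout m s a b ->
  j ∘ a = y -> j ∘ b = mv -> M j.
Proof.
intros Mm Nv pbV vy vs ms poW ja jb.
assert (Mmv : M mv).
{ apply (M_pullback hpre (is_pullback_sym pbV)); exact Mm. }
assert (Nv' : N v') by exact (N_pullback hpre pbV Nv).
assert (mono_mv : is_mono mv) by exact (M_mono hpre Mmv).
assert (sqV : m ∘ v' = v ∘ mv) by (symmetry; apply (proj1 pbV)).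
assert (Ns : N s) by (apply (hsplit (f := s)); exists v'; exact vs).
destruct (adhesive_pushouts hMN Mmv Nv') as (R & r & k & poR).
destruct (proj2 poR A v m (eq_sym sqV)) as (w & [wr wk] & _).
(* Pulling [B], [A], [V] back along [mv] gives [B], [B], [V], whose pushout is [V]; so [W] pulls
   back to [V]. *)
assert (pbVW : is_pullback b (idm V) j mv).
{ apply (van_kampen_stable (g' := idm B) (m' := s) (n' := s) (f' := idm V)
           (a := idm B) (b := m) (c := idm V) hpb
           (adhesive_van_kampen hMN Mm Ns poW));
    rewrite ?comp_idl, ?comp_idr; auto.
  - apply pushout_id.
  - symmetry; apply (proj1 poW).
  - rewrite ja, <- ms. apply mono_pullback; exact mono_mv.
  - rewrite ja. apply is_pullback_sym.
    apply (pullback_along_section mono_mv sqV vy ms vs).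
  - rewrite jb. exact (mono_kernel_pair mono_mv). }
assert (rym : r ∘ y ∘ m = k).
{ rewrite <- comp_assoc, <- ms, comp_assoc, (proj1 poR), <- comp_assoc, vs.
  apply comp_idr. }
(* Cube over the pushout [R], with vertical arrows [idm V], [j], [idm B], [r ∘ y]. *)
assert (pbW : is_pullback (v ∘ j) j (r ∘ y) r).
{ apply (adhesive_van_kampen hMN Mmv Nv' poR) with
    (g' := b) (m' := v') (f' := m) (a := idm V) (c := idm B).
  - rewrite <- comp_assoc, jb; auto.
  - apply (pushout_hom_ext poW); rewrite <- !comp_assoc.
    + rewrite ja, vy, comp_idr; reflexivity.
    + rewrite jb, <- sqV, (proj1 poR), !comp_assoc, rym; reflexivity.
  - rewrite comp_idr; exact rym.
  - exact pbVW.
  - apply pullback_id.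
  (* The top face is a pushout: pushing [W = A +_B V] out along [v'] leaves [A +_B B = A], since
     [v' ∘ s = idm B]. *)
  - split; [rewrite <- comp_assoc, jb; auto|].
    intros T x z xz; exists (x ∘ a).
    assert (xam : x ∘ a ∘ m = z).
    { rewrite <- comp_assoc, (proj1 poW), comp_assoc, xz, <- comp_assoc, vs.
      apply comp_idr. }
    repeat split; auto.
    + apply (pushout_hom_ext poW); rewrite <- !comp_assoc.
      * rewrite ja, vy, comp_idr; reflexivity.
      * rewrite jb, <- sqV, xz, !comp_assoc, xam; reflexivity.
    + intros t [<- _].
      rewrite <- !comp_assoc, ja, vy; apply comp_idr. }
apply (M_pullback hpre pbW).
apply (hsplit (f := r ∘ y)); exists w.
rewrite comp_assoc, wr; exact vy.
Qed.

Lemma pushout_union_M (A B C P D : X) (m : hom B A) (n : hom C A)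
    (p : hom P B) (q : hom P C) (i1 : hom C D) (i2 : hom B D) (u : hom D A) :
  M m -> inter M N n -> is_pullback q p n m -> is_pushout q p i1 i2 ->
  u ∘ i1 = n -> u ∘ i2 = m -> M u.
Proof.
intros Mm [Mn Nn] pbP poD ui1 ui2.
assert (sqP : m ∘ p = n ∘ q) by (symmetry; apply (proj1 pbP)).
destruct (adhesive_pushouts hMN Mn Nn) as (Q & y1 & y2 & poQ).
destruct (proj2 poQ A (idm A) (idm A) eq_refl) as (v & [vy1 vy2] & _).
assert (Nv : N v).
{ apply hcodiag; exists C, n; repeat split; auto.
  exists y1, y2; auto. }
(* The two copies of [A] in [Q] meet exactly in [C]. *)
assert (pbQ : is_pullback n n y2 y1).
{ apply van_kampen_is_pullback; [exact (M_mono hpre Mn)|].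
  exact (adhesive_van_kampen hMN Mn Nn poQ). }
destruct (hpb v m) as (V & mv & v' & pbV).
assert (sqV : m ∘ v' = v ∘ mv) by (symmetry; apply (proj1 pbV)).
assert (Mmv : M mv).
{ apply (M_pullback hpre (is_pullback_sym pbV)); exact Mm. }
(* Every section of [v] restricts over [B] to a section of [v']. *)
assert (sec : forall y, v ∘ y = idm A ->
  exists s, mv ∘ s = y ∘ m /\ v' ∘ s = idm B).
{ intros y vy.
  destruct (proj2 pbV B (y ∘ m) (idm B)) as (s & e & _).
  - rewrite comp_assoc, vy, comp_idl, comp_idr; reflexivity.
  - exists s; exact e. }
destruct (sec y1 vy1) as (s1 & ms1 & vs1).
destruct (sec y2 vy2) as (s2 & ms2 & vs2).
assert (Ns : N s2) by (apply (hsplit (f := s2)); exists v'; exact vs2).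
destruct (adhesive_pushouts hMN Mm Ns) as (W & a & b & poW).
destruct (proj2 poW Q y2 mv (eq_sym ms2)) as (j & [ja jb] & _).
assert (Mj : M j).
{ exact (section_union_M Mm Nv pbV vy2 vs2 ms2 poW ja jb). }
assert (Qeq : y2 ∘ n = y1 ∘ n) by apply (proj1 pbQ).
(* As [j] is monic, this is checked in [Q], where both sides become [y1 ∘ n ∘ q]. *)
assert (cocone : a ∘ n ∘ q = b ∘ s1 ∘ p).
{ apply (M_mono hpre Mj).
  rewrite !comp_assoc, ja, jb, ms1, Qeq, <- !comp_assoc, sqP; reflexivity. }
destruct (proj2 poD W _ _ cocone) as (d & [di1 di2] & _).
(* Along [y1], the pieces [B], [A], [V] of [W] pull back to [P], [C], [B], whose pushout is [D]. *)
assert (pbD : is_pullback d u j y1).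
{ apply (van_kampen_stable (a := p) (b := n) (c := s1) hpb
           (adhesive_van_kampen hMN Mm Ns poW) poD); auto.
  - apply (M_mono hpre Mmv).
    rewrite !comp_assoc, ms1, ms2, <- !comp_assoc, sqP, !comp_assoc.
    rewrite Qeq; reflexivity.
  - rewrite ui1, ja. apply (pullback_paste pbQ pbP).
  - rewrite ui1, ja; exact pbQ.
  - rewrite ui2, jb.
    exact (pullback_along_section (M_mono hpre Mmv) sqV vy1 ms1 vs1). }
exact (M_pullback hpre pbD Mj).
Qed.

End Union.

Theorem theorem5p5 (X : category) (M N : arrows X)
    (hMN : adhesive M N)
    (hpb : has_pullbacks X)
    (hsplit : forall (A B : X) (f : hom A B),
       is_split_mono f -> inter M N f)
    (hcodiag : forall (Q B : X) (v : hom Q B),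
       is_MN_codiagonal M N v -> N Q B v) :
  closed_MN_unions M N.
Proof.
intros U A u (hu & B & m & hm & C & n & hn & Mm & MNn & mU & nU & least).
pose proof (adhesive_preadhesive hMN) as hpre.
apply sub_le_of in mU; destruct mU as [mU umU].
apply sub_le_of in nU; destruct nU as [nU unU].
destruct (hpb _ _ _ n m) as (P & q & p & pbP).
(* The legs of the span out of [P] fall into different classes: [p] inherits [N] from [n], and [q]
   inherits [M] from [m]. Hence their pushout exists. *)
pose proof (N_pullback hpre pbP (proj2 MNn)) as Np.
pose proof (M_pullback hpre (is_pullback_sym pbP) Mm) as Mq.
destruct (adhesive_pushouts hMN Mq Np) as (D & i1 & i2 & poD).
destruct (proj2 poD A n m (proj1 pbP)) as (w & [wi1 wi2] & _).
assert (Mw : M _ _ w).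
{ exact (pushout_union_M hMN hpb hsplit hcodiag Mm MNn pbP poD wi1 wi2). }
pose proof (M_mono hpre Mw) as hw.
assert (le : sub_le (sub_of hu) (sub_of hw)).
{ apply least; apply sub_le_of; [exists i2 | exists i1]; assumption. }
apply sub_le_of in le; destruct le as [h wh].
(* Conversely, [nU] and [mU] agree on [P] because [u] is monic, so [w] factors through [u]; the two
   factorizations are mutually inverse. *)
destruct (proj2 poD U nU mU) as (h' & [h'i1 h'i2] & _).
{ apply hu; rewrite !comp_assoc, unU, umU; exact (proj1 pbP). }
assert (uh' : u ∘ h' = w).
{ apply (pushout_hom_ext poD); rewrite <- comp_assoc.
  - rewrite h'i1, unU; auto.
  - rewrite h'i2, umU; auto. }
rewrite <- wh; apply (M_comp hpre); [|exact Mw].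
apply (M_isos hpre); exists h'; split.
- apply hu; rewrite comp_assoc, uh', wh, comp_idr; reflexivity.
- apply hw; rewrite comp_assoc, wh, uh', comp_idr; reflexivity.
Qed.
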